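(* Let $I\subseteq\mathbb{Q}[x_1,\dots,x_n]$ be a zero-dimensional pure difference binomial ideal. Then there exists a primitive root of unity $\xi_l=\exp(2\pi \mathrm{i}/l)\in\mathbb{C}$, $l\geq 1$, such that all complex solutions of $I$ are contained in the cyclotomic field $\mathbb{Q}(\xi_l)$; that is, every point $p\in\mathbb{C}^n$ with $f(p)=0$ for all $f\in I$ has all its coordinates in $\mathbb{Q}(\xi_l)$.
   Context: A pure difference binomial ideal is an ideal which can be generated by differences $x^a-x^b$ of monic monomials. *)

(* Defs.v *)
From HB Require Import structures.
From mathcomp Require Import all_boot all_order all_algebra.
From mathcomp Require Import complex.
From mathcomp Require Import mpoly.
From mathcomp Require Import reals.
From mathcomp Require sequences trigo.

Set Implicit Arguments.
Unset Strict Implicit.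
Unset Printing Implicit Defensive.

Import Order.TTheory GRing.Theory Num.Theory.
Local Open Scope ring_scope.
Local Open Scope complex_scope.

(* [idealr] is the type of proper ideals.  Properness excludes no pure
   difference binomial ideal, since all differences of monomials vanish at the
   point (1, ..., 1), and is implied by having Krull dimension 0.  Membership
   is boolean, which under classical logic is no restriction. *)

Definition generated_by (R : comNzRingType) (I : idealr R) (S : R -> Prop) :=
  forall f : R, f \in I <->
    exists r : seq (R * R),
      (forall q, q \in r -> S q.2) /\ f = \sum_(q <- r) q.1 * q.2.

Definition pure_difference (k : nzRingType) (n : nat) (f : {mpoly k[n]}) :=
  exists a b : 'X_{1..n}, f = 'X_[a] - 'X_[b].

Definition pure_difference_binomial_ideal (k : fieldType) (n : nat)
    (I : idealr {mpoly k[n]}) :=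
  exists S : {mpoly k[n]} -> Prop,
    (forall f, S f -> pure_difference f) /\ generated_by I S.

Definition prime_chain_over (R : comNzRingType) (I : idealr R) (d : nat)
    (P : 'I_d.+1 -> prime_idealr R) :=
  (forall i, {subset I <= P i}) /\
  (forall i j : 'I_d.+1, (i < j)%N ->
     {subset P i <= P j} /\ ~ {subset P j <= P i}).

(* The Krull dimension of R / I is d. *)
Definition ideal_dimension (R : comNzRingType) (I : idealr R) (d : nat) :=
  (exists P, @prime_chain_over R I d P) /\
  (forall e, (exists P, @prime_chain_over R I e P) -> (e <= d)%N).

Definition zero_dimensional (R : comNzRingType) (I : idealr R) :=
  ideal_dimension I 0.

Definition solution (R : realType) (n : nat) (I : idealr {mpoly rat[n]})
    (p : 'I_n -> R[i]) :=
  forall f, f \in I -> (map_mpoly ratr f).@[p] = 0.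

Definition cexp (R : realType) (z : R[i]) : R[i] :=
  (sequences.expR (complex.Re z))%:C *
  (trigo.cos (complex.Im z) +i* trigo.sin (complex.Im z)).

Definition xi (R : realType) (l : nat) : R[i] :=
  cexp (2%:R * (trigo.pi : R)%:C * 'i / l%:R).

(* Membership in the smallest subfield of L that contains x; for L of
   characteristic 0 this subfield is Q(x). *)
Definition in_adjoin (L : fieldType) (x z : L) :=
  forall K : divringClosed L, x \in K -> z \in K.

(* Main.v *)
Require Import Defs.
From HB Require Import structures.
From mathcomp Require Import all_boot all_order all_algebra.
From mathcomp Require Import complex.
From mathcomp Require Import mpoly.
From mathcomp Require Import boolp reals.
From mathcomp Require Import ring.
From mathcomp Require exp trigo.

(** A coordinate of a solution is zero or a root of unity, with one exponent
    that serves all solutions; this is what zero-dimensionality provides.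

    Fix a set Z of coordinates and look at the solutions p that vanish exactly
    on Z.  The Laurent monomials in the remaining coordinates that take the
    value 1 at all these p form a subgroup H of Z^n, through their exponent
    vectors ([solution_relations]); exponents on Z are unconstrained.  If no
    solution vanishes exactly on Z there is nothing to prove.  A subgroup
    of Z^n either has finite index, and then contains m Z^n for some m > 0, or
    is orthogonal to some nonzero integer vector w
    ([subgroup_finite_index_or_orthogonal]).

    In the first case p_j ^ m = 1 for all j outside Z.  In the second case w
    vanishes on Z, and zero-dimensionality is contradicted
    ([torus_curve_not_zero_dimensional]): the point with coordinates t ^ w_j
    outside Z and 0 on Z is a zero of I over Q(t).  Indeed, since some p solves
    the equation x^a = x^b of a generator, either both monomials involve a
    variable of Z and both vanish at the point, or neither does, and then
    a - b lies in H, hence is orthogonal to w.  The polynomials that vanish at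
    this generic point form a prime ideal over I, and those that vanish at its
    specialisation t = 1 form a strictly larger one, as they include x_j - 1
    for every j with w_j nonzero.

    There are finitely many sets Z, so the exponents m have a common multiple l
    ([exists_common_multiple]).  Since xi_l is a primitive l-th root of unity
    ([xi_primitive]), every nonzero coordinate is a power of it. *)

Set Implicit Arguments.
Unset Strict Implicit.
Unset Printing Implicit Defensive.

Import Order.TTheory GRing.Theory Num.Theory.
Local Open Scope ring_scope.
Local Open Scope complex_scope.

(** * Subgroups of the integer lattice *)

(** The product of the individual exponents serves every index, since
    admissible exponents are closed under multiples. *)
Lemma exists_common_multiple (T : finType) (Q : T -> nat -> Prop) :
    (forall x m k, Q x m -> Q x (m * k)%N) ->
    (forall x, exists2 m, (0 < m)%N & Q x m) ->
  exists2 m, (0 < m)%N & forall x, Q x m.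
Proof.
move=> Qmul Qex.
have /fin_all_exists[m mP] : forall x, exists m, (0 < m)%N /\ Q x m.
  by move=> x; have [m m0 Qm] := Qex x; exists m.
exists (\prod_x m x)%N; first by rewrite prodn_cond_gt0 // => x _; case: (mP x).
by move=> x; rewrite (bigD1 x) //=; apply: Qmul; case: (mP x).
Qed.

Lemma clear_denominators n (u : 'cV[rat]_n) :
  exists2 m : int, m != 0 & exists w : 'cV[int]_n, m%:~R *: u = map_mx intr w.
Proof.
exists (\prod_i denq (u i 0)); first by
  apply/prodf_neq0 => i _; rewrite denq_neq0.
exists (\col_i (numq (u i 0) * \prod_(j | j != i) denq (u j 0))).
apply/matrixP => i j; rewrite !mxE (ord1 j) (bigD1 i) //= !intrM.
rewrite mulrAC -{2}[u i 0]divq_num_den [_ * (_ / _)]mulrC.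
by rewrite divfK ?intr_eq0 ?denq_neq0.
Qed.

Lemma map_intr_inj m n :
  injective (map_mx intr : 'M[int]_(m, n) -> 'M[rat]_(m, n)).
Proof.
move=> A B /matrixP AB; apply/matrixP => i j.
by apply: (@intr_inj rat); have := AB i j; rewrite !mxE.
Qed.

Lemma subgroup_mulmx n (H : 'rV[int]_n -> Prop) k (A : 'M[int]_(k, n)) v :
    H 0 -> (forall u v, H u -> H v -> H (u - v)) -> (forall i, H (row i A)) ->
  H (v *m A).
Proof.
move=> H0 HB HA.
have HN u : H u -> H (- u) by move=> Hu; rewrite -[- u]sub0r; apply: HB.
have HD u w : H u -> H w -> H (u + w).
  by move=> Hu Hw; rewrite -[w]opprK; apply/HB/HN.
have HM u m : H u -> H (u *+ m).
  by move=> Hu; elim: m => [|m IH]; rewrite ?mulr0n // mulrS; apply: HD.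
rewrite mulmx_sum_row; apply: (big_ind H) => // i _.
case: (v 0 i) => m; rewrite ?NegzE ?scaleNr -?pmulrn -?natz scaler_nat.
  exact: HM.
exact/HN/HM.
Qed.

(** A family in [H] of maximal rank spans [H] over the rationals, as any element
    outside its span could be appended to raise the rank.  The rank is at most
    [n], so the extension stops: the induction is on the corank. *)
Lemma subgroup_spanning_family n (H : 'rV[int]_n -> Prop) :
  exists k (A : 'M[int]_(k, n)), (forall i, H (row i A)) /\
    forall v, H v -> (map_mx intr v <= (map_mx intr A : 'M[rat]_(k, n)))%MS.
Proof.
pose QA k (A : 'M[int]_(k, n)) : 'M[rat]_(k, n) := map_mx intr A.
suff: forall c k (A : 'M[int]_(k, n)), (forall i, H (row i A)) ->
    (n - \rank (QA k A) <= c)%N ->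
    exists k (A : 'M[int]_(k, n)), (forall i, H (row i A)) /\
    forall v, H v -> (map_mx intr v <= QA k A)%MS.
  by move=> /(_ n 0%N 0); apply; [case | rewrite leq_subr].
elim=> [|c IH] k A HA rA;
  have [Hall|] := pselect (forall v, H v -> (map_mx intr v <= QA k A)%MS);
  try by exists k, A.
  case; move=> v _; apply: submx_full.
  by rewrite /row_full eqn_leq rank_leq_col /= -subn_eq0 -leqn0.
move=> /existsNP[v /not_implyP[Hv /negP nv]].
apply: (IH _ (col_mx A v)) => [i|].
  by case: (split_ordP i) => j ->; rewrite ?rowKu ?rowKd // row_id.
have lt : (QA _ A < QA _ (col_mx A v))%MS.
  rewrite /QA map_col_mx ltmxE -!addsmxE addsmxSl /=.
  by rewrite addsmx_sub submx_refl.
move: rA; rewrite !leq_subLR addnS -addSn => /leq_trans; apply.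
by rewrite leq_add2r; apply: rank_ltmx.
Qed.

(** Take a family [A] in [H] that spans [H] over the rationals.  If its rank is
    [n], some [n] of its rows form a square matrix [B] with nonzero determinant,
    and the adjugate of [B] shows that [H] contains all multiples of that
    determinant.  Otherwise the rows of [A], hence [H], are orthogonal to a
    nonzero rational vector, which can be taken integral. *)
Lemma subgroup_finite_index_or_orthogonal n (H : 'rV[int]_n -> Prop) :
    H 0 -> (forall u v, H u -> H v -> H (u - v)) ->
  (exists2 m, (0 < m)%N & forall v, H (v *+ m)) \/
  (exists2 w : 'cV[int]_n, w != 0 & forall v, H v -> v *m w = 0).
Proof.
move=> H0 HB; have [k [A [HA Amax]]] := subgroup_spanning_family H.
set AQ := map_mx _ A in Amax.
have [full|nfull] := boolP (row_full AQ); [left | right].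
  pose B := rowsub (fullrankfun full) A.
  have dB : \det B != 0.
    have: rowsub (fullrankfun full) AQ \in unitmx.
      exact: fullrowsub_unit.
    by rewrite -map_mxsub unitmxE det_map_mx unitfE intr_eq0.
  exists `|\det B|%N => [|v]; first by rewrite absz_gt0.
  suff -> : v *+ `|\det B|%N = (Num.sg (\det B) *: v *m \adj B) *m B.
    apply: subgroup_mulmx => // i.
    suff -> : row i B = row (fullrankfun full i) A by [].
    by apply/rowP => j; rewrite !mxE.
  rewrite -mulmxA mul_adj_mx mul_mx_scalar scalerA -scaler_nat natz abszE.
  by rewrite mulrC -normrEsg.
have ker0 : kermx AQ^T != 0 by rewrite kermx_eq0 /row_free mxrank_tr.
have [i u0] : exists i, row i (kermx AQ^T) != 0.
  apply/existsP; apply: contraR ker0 => /existsPn u0.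
  apply/eqP/row_matrixP => i; rewrite row0; apply/eqP.
  by rewrite -[_ == _]negbK.
set u := row i _ in u0.
have uA : u *m AQ^T = 0 by apply/sub_kermxP; rewrite row_sub.
have [m m0 [w wu]] := clear_denominators u^T.
exists w => [|v /Amax/submxP[c vc]].
  apply: contraNneq u0 => w0; move: wu; rewrite w0 map_mx0 => /eqP.
  by rewrite scaler_eq0 intr_eq0 (negPf m0) /= trmx_eq0.
apply: map_intr_inj.
rewrite map_mxM map_mx0 vc -wu -mulmxA -scalemxAr -[AQ]trmxK -trmx_mul uA.
by rewrite trmx0 scaler0 mulmx0.
Qed.

(** * Curves of zeros and the Krull dimension *)

Definition rmorph_ker (R : comNzRingType) (S : idomainType)
    (phi : {rmorphism R -> S}) : {pred R} := [pred f | phi f == 0].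

Section RmorphKer.
Variables (R : comNzRingType) (S : idomainType) (phi : {rmorphism R -> S}).

Lemma rmorph_ker_idealr : idealr_closed (rmorph_ker phi).
Proof.
split=> [||a u v]; rewrite !inE ?rmorph0 ?rmorph1 ?oner_eq0 //.
by move=> /eqP u0 /eqP v0; rewrite rmorphD rmorphM u0 v0 mulr0 addr0.
Qed.

Lemma rmorph_ker_prime : prime_idealr_closed (rmorph_ker phi).
Proof. by move=> u v; rewrite !inE rmorphM mulf_eq0. Qed.

HB.instance Definition _ := isIdealr.Build R (rmorph_ker phi) rmorph_ker_idealr.
HB.instance Definition _ :=
  isPrimeIdealrClosed.Build R (rmorph_ker phi) rmorph_ker_prime.

Definition prime_ker : prime_idealr R := rmorph_ker phi.

Lemma mem_prime_ker f : (f \in prime_ker) = (phi f == 0).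
Proof. by []. Qed.

End RmorphKer.

Lemma prime_chain_not_zero_dimensional (R : comNzRingType) (I : idealr R)
    (P Q : prime_idealr R) :
    {subset I <= P} -> {subset P <= Q} -> ~ {subset Q <= P} ->
  ~ zero_dimensional I.
Proof.
move=> IP PQ nQP [_ /(_ 1%N)].
suff h : exists C, @prime_chain_over R I 1 C by move/(_ h).
exists (fun i => if i == ord0 then P else Q); split=> [i f If|i j].
  by case: ifP => _; [|apply: PQ]; apply: IP.
by case: i => [[|[|//]]] /= ?; case: j => [[|[|//]]] /= ?.
Qed.

Definition meets n (Z : {set 'I_n}) (a : 'X_{1..n}) :=
  [exists j in Z, a j != 0%N].

Definition weight n (w : 'cV[int]_n) (a : 'X_{1..n}) : int :=
  \sum_j (a j)%:Z * w j 0.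

(** For varying [t], a one-parameter subgroup of the torus of points that vanish
    exactly on [Z]; at [t = 1] its nonzero coordinates are all 1. *)
Definition torus_point n (F : fieldType) (Z : {set 'I_n}) (w : 'cV[int]_n)
    (t : F) : 'I_n -> F := fun j => if j \in Z then 0 else t ^ w j 0.

(** Outside the variables of [Z], a monomial restricts to a character of the
    one-parameter subgroup; its weight is the pairing of the exponents with
    [w]. *)
Lemma mmap1_torus_point n (F : fieldType) Z (w : 'cV[int]_n) (t : F) a :
  t != 0 ->
  mmap1 (torus_point Z w t) a = if meets Z a then 0 else t ^ weight w a.
Proof.
move=> t0; rewrite /mmap1 /torus_point; case: ifPn => [/exists_inP[j Zj aj]|].
  by rewrite (bigD1 j) //= Zj expr0n (negPf aj) mul0r.
move=> /exists_inPn aZ.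
rewrite /weight (big_morph (exprz t) (fun x y => expfzDr x y t0) (expr0z t)).
apply: eq_bigr => j _; case: ifPn => [/aZ/negPn/eqP->|_].
  by rewrite mul0r expr0z.
by rewrite mulrC -exprz_exp exprnP.
Qed.

Local Notation "x %:F" := (@tofrac {poly rat} x).

(** The substitution t = 1 on Laurent polynomials, seen inside Q(t).  It is kept
    as a relation because the exponents of t may be negative: [a] only becomes a
    polynomial [N] after multiplication by a power of t, which is 1 at t = 1. *)
Definition specializes_at1 (a : {fraction {poly rat}}) (b : rat) :=
  exists2 N : {poly rat}, N.[1] = b & exists k, a * 'X%:F ^+ k = N%:F.

Lemma specializes_at1D a b c d : specializes_at1 a b -> specializes_at1 c d ->
  specializes_at1 (a + c) (b + d).
Proof.
move=> [N <- [k ak]] [M <- [l cl]].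
exists (N * 'X^l + M * 'X^k); first by rewrite !hornerE !expr1n !mulr1.
exists (k + l)%N; rewrite tofracD !tofracM !tofracXn -ak -cl exprD mulrDl mulrA.
by congr (_ + _); rewrite -!mulrA [X in c * X]mulrC.
Qed.

Lemma specializes_at1M a b c d : specializes_at1 a b -> specializes_at1 c d ->
  specializes_at1 (a * c) (b * d).
Proof.
move=> [N <- [k ak]] [M <- [l cl]].
exists (N * M); first by rewrite hornerM.
by exists (k + l)%N; rewrite tofracM -ak -cl exprD mulrACA.
Qed.

Lemma specializes_at1C c : specializes_at1 c%:P%:F c.
Proof. by exists c%:P; rewrite ?hornerC //; exists 0%N; rewrite mulr1. Qed.

Lemma tofracX_neq0 : ('X : {poly rat})%:F != 0.
Proof. by rewrite tofrac_eq0 polyX_eq0. Qed.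

Lemma specializes_at1Xz (z : int) : specializes_at1 ('X%:F ^ z) 1.
Proof.
case: z => m; first exists 'X^m; rewrite ?hornerXn ?expr1n //.
  by exists 0%N; rewrite mulr1 tofracXn.
exists 1; first by rewrite hornerC.
by exists m.+1; rewrite NegzE -exprnN mulVf ?expf_neq0 ?tofracX_neq0.
Qed.

(** The substitution is well defined at 0, which is all that the inclusion of
    the two vanishing ideals requires. *)
Lemma specializes_at1_0 b : specializes_at1 0 b -> b = 0.
Proof.
move=> [N <- [k]]; rewrite mul0r => /esym/eqP.
by rewrite tofrac_eq0 => /eqP->; rewrite horner0.
Qed.

Lemma specializes_torus_point n Z (w : 'cV[int]_n) (f : {mpoly rat[n]}) :
  specializes_at1
    (mmap (@tofrac {poly rat} \o polyC) (torus_point Z w 'X%:F) f)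
    (mmap idfun (torus_point Z w 1) f).
Proof.
rewrite /mmap; apply: (big_ind2 specializes_at1).
- exact: (specializes_at1C 0).
- exact: specializes_at1D.
move=> a _; apply: specializes_at1M; first exact: specializes_at1C.
rewrite !mmap1_torus_point ?oner_eq0 ?tofracX_neq0 //; case: ifP => _.
  exact: (specializes_at1C 0).
by rewrite exp1rz; apply: specializes_at1Xz.
Qed.

Lemma tofracXz_eq1 (z : int) : 'X%:F ^ z = 1 :> {fraction {poly rat}} -> z = 0.
Proof.
move=> Xz.
have : 'X%:F ^+ `|z|%N = 1 :> {fraction {poly rat}}.
  by case: z Xz => m // /(congr1 GRing.inv); rewrite NegzE -exprnN invrK invr1.
rewrite -tofracXn -tofrac1 => /eqP; rewrite tofrac_eq.
move=> /eqP/(congr1 (size : {poly rat} -> nat)).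
by rewrite size_polyXn size_poly1 => -[/eqP]; rewrite absz_eq0 => /eqP.
Qed.

(** The vanishing ideals of the generic point of the curve and of its point at
    [t = 1] form a chain of primes over [I].  It is strict because the curve is
    not constant: ['X_j - 1] vanishes at [t = 1], but not identically. *)
Lemma torus_curve_not_zero_dimensional n (I : idealr {mpoly rat[n]}) S Z
    (w : 'cV[int]_n) j :
    generated_by I S ->
    (forall f, S f -> exists a b,
       [/\ f = 'X_[a] - 'X_[b], meets Z a = meets Z b &
       ~~ meets Z a -> weight w a = weight w b]) ->
    j \notin Z -> w j 0 != 0 ->
  ~ zero_dimensional I.
Proof.
move=> genI binS Zj wj.
pose P0 := prime_ker
  (mmap (@tofrac {poly rat} \o polyC) (torus_point Z w 'X%:F)).
pose P1 := prime_ker (mmap (idfun : rat -> rat) (torus_point Z w (1 : rat))).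
apply: (@prime_chain_not_zero_dimensional _ _ P0 P1).
- move=> f /genI[r [Sr ->]]; rewrite big_seq; apply: rpred_sum => q /Sr.
  move=> /binS[a [b [-> mab wab]]]; apply: idealMr; rewrite mem_prime_ker.
  rewrite raddfB /= !mmapX !mmap1_torus_point ?tofracX_neq0 // -mab.
  by case: ifPn wab => [_ _|_ ->] //; rewrite subrr.
- move=> f; rewrite !mem_prime_ker => /eqP f0; apply/eqP.
  by apply: specializes_at1_0; rewrite -f0; apply: specializes_torus_point.
move=> /(_ ('X_j - 1)); rewrite !mem_prime_ker !rmorphB !rmorph1 /=.
rewrite !mmapX !mmap1U.
rewrite /torus_point (negPf Zj) exp1rz subrr eqxx => /(_ isT); rewrite subr_eq0.
by move=> /eqP/tofracXz_eq1/eqP; apply/negP.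
Qed.

(** * Roots of unity *)

(** De Moivre's formula. *)
Lemma cis_exp (R : realType) (x : R) k :
  (trigo.cos x +i* trigo.sin x) ^+ k =
  trigo.cos (x *+ k) +i* trigo.sin (x *+ k).
Proof.
elim: k => [|k IH]; first by rewrite mulr0n trigo.cos0 trigo.sin0.
rewrite exprS IH mulrS trigo.cosD trigo.sinD; apply/eqP.
by rewrite eq_complex /= eqxx /= addrC.
Qed.

Lemma xiE (R : realType) l :
  xi R l =
  trigo.cos (trigo.pi *+ 2 / l%:R) +i* trigo.sin (trigo.pi *+ 2 / l%:R).
Proof.
rewrite /xi /cexp.
have -> : 2%:R * (trigo.pi : R)%:C * 'i / l%:R = 0 +i* (trigo.pi *+ 2 / l%:R).
  have -> : (l%:R : R[i]) = l%:R%:C by rewrite rmorph_nat.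
  rewrite -fmorphV -mulr_natl.
  apply/eqP; rewrite eq_complex /=; simpc.
  by rewrite mulrDl mul1r mulr2n eqxx.
by rewrite /= exp.expR0 mul1r.
Qed.

(** By the double angle formula, [1 - cos x] is twice the square of
    [sin (x / 2)], and [x / 2] lies strictly between 0 and pi. *)
Lemma cos_neq1 (R : realType) (x : R) :
  0 < x < trigo.pi *+ 2 -> trigo.cos x != 1.
Proof.
move=> /andP[x0 x2]; have s0 : 0 < trigo.sin (x / 2).
  by apply: trigo.sin_gt0_pi; rewrite divr_gt0 //= ltr_pdivrMr // mulr_natr.
have -> : x = x / 2 *+ 2 by rewrite -mulr_natr divfK ?pnatr_eq0.
rewrite trigo.cos_mulr2n trigo.cos2sin2; rewrite -subr_eq0.
have -> : (1 - trigo.sin (x / 2) ^+ 2) *+ 2 - 1 - 1 =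
        - (trigo.sin (x / 2) ^+ 2 *+ 2) by ring.
by rewrite oppr_eq0 mulrn_eq0 /= expf_eq0 /= gt_eqF.
Qed.

Lemma xi_primitive (R : realType) l : (0 < l)%N -> l.-primitive_root (xi R l).
Proof.
move=> l0; apply/andP; split=> //; apply/forallP => k.
rewrite unity_rootE xiE cis_exp.
have lR : (l%:R : R) != 0 by rewrite pnatr_eq0 -lt0n.
have [->|kl] /= := eqVneq k.+1 l.
  by rewrite -mulrnAl -mulr_natr mulfK // trigo.cos2pi trigo.sin2pi eqxx.
rewrite eq_complex /= (negPf (cos_neq1 _)) //.
have pi2 : 0 < trigo.pi *+ 2 :> R by rewrite mulrn_wgt0 ?trigo.pi_gt0.
rewrite mulrn_wgt0 ?divr_gt0 ?ltr0n //= -[_ *+ k.+1]mulr_natr mulrAC.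
by rewrite ltr_pdivrMr ?ltr0n // ltr_pM2l // ltr_nat ltn_neqAle kl ltn_ord.
Qed.

(** * Multiplicative relations between the coordinates of solutions *)

Definition solution_relations (R : realType) n (I : idealr {mpoly rat[n]})
    (Z : {set 'I_n}) (v : 'rV[int]_n) :=
  forall p : 'I_n -> R[i], solution I p -> [set j | p j == 0] = Z ->
    \prod_(j in ~: Z) p j ^ v 0 j = 1.

Lemma solution_relationsB (R : realType) n (I : idealr {mpoly rat[n]}) Z u v :
  solution_relations R I Z u -> solution_relations R I Z v ->
  solution_relations R I Z (u - v).
Proof.
move=> Hu Hv p Ip pZ.
transitivity ((\prod_(j in ~: Z) p j ^ u 0 j) / \prod_(j in ~: Z) p j ^ v 0 j);
  last by rewrite Hu // Hv // divr1.
rewrite -prodf_div; apply: eq_bigr => j; rewrite -pZ !inE => pj.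
by rewrite !mxE expfzDr // invr_expz.
Qed.

Lemma eval_monomial (F : fieldType) n (p : 'I_n -> F) (a : 'X_{1..n}) :
  \prod_j p j ^+ a j =
  if meets [set j | p j == 0] a then 0
  else \prod_(j in ~: [set j | p j == 0]) p j ^+ a j.
Proof.
case: ifPn => [/exists_inP[j]|/exists_inPn aZ].
  by rewrite inE => /eqP pj aj; rewrite (bigD1 j) //= pj
       expr0n (negPf aj) mul0r.
rewrite (bigID (mem [set j | p j == 0])) /= big1 ?mul1r.
  by apply: eq_bigl => j; rewrite !inE.
by move=> j /aZ/negPn/eqP->; rewrite expr0.
Qed.

(** A monomial vanishes at [p] exactly when it involves a vanishing coordinate.
    The two monomials of a binomial in [I] agree at [p], so they vanish
    together, and when they do not vanish their quotient is a relation. *)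
Lemma binomial_on_solution (R : realType) n (I : idealr {mpoly rat[n]})
    (p : 'I_n -> R[i]) (a b : 'X_{1..n}) :
    solution I p -> 'X_[a] - 'X_[b] \in I ->
  let Z := [set j | p j == 0] in
  meets Z a = meets Z b /\
  (~~ meets Z a -> \prod_(j in ~: Z) p j ^ ((a j)%:Z - (b j)%:Z) = 1).
Proof.
move=> Ip /Ip; rewrite raddfB /= !map_mpolyX mevalB !mevalX => /eqP.
rewrite subr_eq0 !eval_monomial; set Z := [set j | _].
have nz c : \prod_(j in ~: Z) p j ^+ c j != 0.
  by apply/prodf_neq0 => j; rewrite !inE => pj; rewrite expf_neq0.
case: ifPn => ma; case: ifPn => mb.
- by [].
- by rewrite eq_sym (negPf (nz _)).
- by rewrite (negPf (nz _)).
move=> /eqP ab; split=> // _.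
transitivity ((\prod_(j in ~: Z) p j ^+ a j) / \prod_(j in ~: Z) p j ^+ b j).
  rewrite -prodf_div; apply: eq_bigr => j; rewrite !inE => pj.
  by rewrite expfzDr // exprnN.
by rewrite ab divff.
Qed.

(** Were the relation group of infinite index, a vector [w] orthogonal to it
    would define a curve of zeros of [I].  The exponent does not depend on [p],
    because only relations common to all solutions with zero set [Z] enter. *)
Lemma coordinate_torsion (R : realType) n (I : idealr {mpoly rat[n]})
    (Z : {set 'I_n}) :
    pure_difference_binomial_ideal I -> zero_dimensional I ->
  exists2 m, (0 < m)%N & forall p : 'I_n -> R[i], solution I p ->
    [set j | p j == 0] = Z -> forall j, j \notin Z -> p j ^+ m = 1.
Proof.
move=> [S [binS genI]] dimI.
have [[p [Ip pZ]]|noZ] :=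
    pselect (exists p : 'I_n -> R[i], solution I p /\ [set j | p j == 0] = Z);
  last by exists 1%N => // p Ip pZ; case: noZ; exists p.
have SI f : S f -> f \in I.
  move=> Sf; apply/genI; exists [:: (1, f)]; rewrite big_seq1 mul1r; split=> //.
  by move=> q; rewrite inE => /eqP->.
have [||[m m0 Hm]|[w w0 Hw]] :=
  @subgroup_finite_index_or_orthogonal n (solution_relations R I Z).
- by move=> q _ _; apply: big1 => j _; rewrite mxE expr0z.
- exact: solution_relationsB.
(* Finite index: [m] times the [j]-th unit vector is a relation. *)
- exists m => // q Iq qZ j Zj; have := Hm (delta_mx 0 j) q Iq qZ.
  rewrite (bigD1 j) ?inE //= big1 => [|i /andP[_ ij]].
    by rewrite mulr1 mulmxnE mxE !eqxx mulr1n natz -exprnP.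
  by rewrite mulmxnE mxE (negPf ij) andbF mul0rn expr0z.
have [j wj] : exists j, w j 0 != 0.
  apply/existsP; apply: contraR w0 => /existsPn w0.
  by apply/eqP/colP => j; rewrite mxE; apply/eqP; have := w0 j; rewrite negbK.
(* The unit vectors indexed by [Z] are relations, since the products run over
   [~: Z] only; thus [w] vanishes on [Z]. *)
have Zj : j \notin Z.
  apply: contra wj => Zj; have Hj : solution_relations R I Z (delta_mx 0 j).
    move=> q _ _; apply: big1 => i; rewrite inE mxE /= => Zi.
    by case: eqP => [ij|]; rewrite ?expr0z //; rewrite ij Zj in Zi.
  have /matrixP/(_ 0 0) := Hw _ Hj; rewrite -rowE !mxE => ->; exact: eqxx.
case: (torus_curve_not_zero_dimensional genI _ Zj wj dimI) => f Sf.
have [a [b fab]] := binS f Sf; exists a, b; rewrite fab in Sf *.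
have [mab _] := binomial_on_solution Ip (SI _ Sf); rewrite pZ in mab.
split=> // ma.
have Hab : solution_relations R I Z (\row_j ((a j)%:Z - (b j)%:Z)).
  move=> q Iq qZ; have [_] := binomial_on_solution Iq (SI _ Sf).
  rewrite qZ => /(_ ma); apply: etrans.
  by apply: eq_bigr => i _; rewrite mxE.
have /matrixP/(_ 0 0) := Hw _ Hab; rewrite !mxE => ab0.
apply/eqP; rewrite -subr_eq0 /weight -sumrB; apply/eqP; rewrite -[RHS]ab0.
by apply: eq_bigr => i _; rewrite mxE mulrBl.
Qed.

Theorem proposition1 (R : realType) (n : nat) (I : idealr {mpoly rat[n]})
    (hI : pure_difference_binomial_ideal I) (hdim : zero_dimensional I) :
  exists l : nat,
    [/\ (1 <= l)%N, l.-primitive_root (xi R l) &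
        forall p : 'I_n -> R[i], solution I p ->
          forall j : 'I_n, in_adjoin (xi R l) (p j)].
Proof.
have [Z m k pm p Ip pZ j Zj|Z|l l0 pl] := exists_common_multiple
    (Q := fun Z m => forall p : 'I_n -> R[i], solution I p ->
       [set j | p j == 0] = Z -> forall j, j \notin Z -> p j ^+ m = 1).
- by rewrite exprM (pm p) ?expr1n.
- exact: coordinate_torsion.
have prim := xi_primitive R l0; exists l; split=> // p Ip j K xiK.
have [->|pj] := eqVneq (p j) 0; first exact: rpred0.
have /(prim_rootP prim)[k ->] : p j ^+ l = 1.
  by apply: (pl _ p Ip erefl); rewrite inE.
exact: rpredX.
Qed.
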